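(* Let $n$ be a positive integer. Then there is an infinite subset $N$ of the set $\mathbb{N}$ of positive integers such that for each $t\in N$ there are infinitely many Salem numbers $\alpha$ satisfying $\deg(\alpha)=2t$ and such that $\alpha^{n}-1$ is a unit.
   Context: A Salem number is a real algebraic integer greater than $1$ whose other conjugates all lie in the closed unit disc, with at least one conjugate lying on the unit circle. Conjugates and degree are taken over $\mathbb{Q}$. A unit is an algebraic integer whose inverse is also an algebraic integer (equivalently, an algebraic integer of norm $\pm 1$ over $\mathbb{Q}$). *)

(* Defs.v *)
From mathcomp Require Import all_boot all_order all_algebra all_field.
From mathcomp Require Import boolp classical_sets functions cardinality.

Set Implicit Arguments.
Unset Strict Implicit.
Unset Printing Implicit Defensive.

Import Order.TTheory GRing.Theory Num.Theory.

Local Open Scope ring_scope.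

(* All numbers live in [algC], the algebraic closure of Q with its complex
   conjugation and modulus; [minCpoly x] is the monic minimal polynomial of [x]
   over Q, with its coefficients embedded in [algC]. *)

Definition algdeg (x : algC) : nat := (size (minCpoly x)).-1.

Definition conjugate (x z : algC) : Prop := root (minCpoly x) z.

(* The order of [algC] is partial: [1 < x] means that [x - 1] is a positive
   real, so [x \is Num.real] is kept only to spell out the usual definition. *)
Definition Salem (x : algC) : Prop :=
  [/\ x \is Num.real, x \in Aint, 1 < x,
      (forall z : algC, conjugate x z -> z != x -> `|z| <= 1) &
      (exists z : algC, conjugate x z /\ `|z| = 1)].

(* [x != 0] is needed because [0^-1 = 0] in [algC]. *)
Definition alg_unit (x : algC) : Prop :=
  [/\ x != 0, x \in Aint & x^-1 \in Aint].

(* Main.v *)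
Require Import Defs.
From mathcomp Require Import all_boot all_order all_algebra all_field.
From mathcomp Require Import boolp classical_sets functions cardinality.
From mathcomp Require Import ring lra zify.

Set Implicit Arguments.
Unset Strict Implicit.
Unset Printing Implicit Defensive.

Import Order.TTheory GRing.Theory Num.Theory.

Local Open Scope classical_set_scope.
Local Open Scope ring_scope.

(* Let k be even with n | 2k, put t = k + 3, and let D be the monic polynomial
   of degree k + 1 whose roots are 2 cos (pi j / k) for 0 <= j <= k, so that
   z^(k+1) D(z + 1/z) = (z^2 - 1) (z^(2k) - 1).  Consider
     R_a(x) = D(x) (x^2 - a (2x - 1)) - 1   and   S_a(z) = z^t R_a(z + 1/z).
   For large a the sign of R_a between two consecutive roots of D(x) (2x - 1) is
   that of -D(x) (2x - 1); since R_a = -1 at 2 and -2 and k is even, R_a has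
   t - 1 roots in ]-2, 2[ and one root > 2.  Hence S_a has a real root
   alpha > 1, the root 1/alpha, and all its other roots on the unit circle.
   If S_a is not the minimal polynomial of alpha, the cofactor is a monic integer
   polynomial of bounded degree with all its roots in the closed unit disc: there
   are finitely many of those, and a root of S_a determines a, so this happens for
   finitely many a only.  Finally S_a(alpha) = 0 says that a multiple of
   alpha^n - 1 in the ring of algebraic integers equals the unit alpha^t. *)

(** * Sign changes and real roots of polynomials *)

Lemma root_between (F : rcfType) (p : {poly F}) (a b : F) :
  a < b -> p.[a] * p.[b] < 0 -> exists x, [/\ a < x, x < b & root p x].
Proof.
move=> ab pab.
have root_in (q : {poly F}) : q.[a] < 0 -> 0 < q.[b] ->
    exists x, [/\ a < x, x < b & root q x].
  move=> qa qb; have [|x /andP[ax xb] qx] := @poly_ivt F q a b (ltW ab).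
    by rewrite !ltW.
  exists x; split=> //; rewrite lt_neqAle ?ax ?xb andbT;
    apply/eqP=> eqx; move: qx; rewrite rootE.
    by rewrite -eqx lt_eqF.
  by rewrite eqx gt_eqF.
have [pa|pa|pa0] := ltgtP p.[a] 0.
- by apply: root_in => //; move: pab; rewrite nmulr_rlt0.
- have [||x [ax xb]] := root_in (- p); rewrite ?hornerN ?oppr_lt0 ?oppr_gt0 //.
    by move: pab; rewrite pmulr_rlt0.
  by rewrite rootN => px; exists x.
- by move: pab; rewrite pa0 mul0r ltxx.
Qed.

(** The [t] open intervals are disjoint, so the roots found in them are distinct and exhaust the
    degree of [p]. *)
Lemma roots_of_sign_changes (F : rcfType) (p : {poly F}) (t : nat) (y : nat -> F) :
  p \is monic -> size p = t.+1 ->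
  (forall i, (i < t)%N -> y i < y i.+1) ->
  (forall i, (i < t)%N -> p.[y i] * p.[y i.+1] < 0) ->
  exists2 rho : nat -> F,
    forall i, (i < t)%N -> y i < rho i /\ rho i < y i.+1 &
    p = \prod_(i < t) ('X - (rho i)%:P).
Proof.
move=> pmon psz ylt psign.
have /choice[rho rhoP] i : exists x, (i < t)%N ->
    [/\ y i < x, x < y i.+1 & root p x].
  have [it|ti] := ltnP i t; last by exists 0.
  by have [x px] := root_between (ylt i it) (psign i it); exists x.
exists rho; first by move=> i /rhoP[].
have ymono i d : (i + d <= t)%N -> y i <= y (i + d)%N.
  elim: d => [|d IH]; first by rewrite addn0.
  by rewrite addnS => h; rewrite (le_trans (IH (ltnW h))) // ltW ?ylt.
have rlt i j : (i < j)%N -> (j < t)%N -> rho i < rho j.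
  move=> ij jt; have [_ h1 _] := rhoP i (ltn_trans ij jt).
  have [h2 _ _] := rhoP j jt; apply: lt_trans h1 (le_lt_trans _ h2).
  by rewrite -(subnKC ij) ymono // subnKC // ltnW.
pose rs := map rho (iota 0 t).
have -> : \prod_(i < t) ('X - (rho i)%:P) = \prod_(z <- rs) ('X - z%:P).
  by rewrite big_map -(big_mkord xpredT (fun i => 'X - (rho i)%:P)) /index_iota subn0.
rewrite [LHS](@all_roots_prod_XsubC _ p rs) ?(monicP pmon) ?scale1r //.
- by rewrite size_map size_iota psz.
- by apply/allP=> _ /mapP[i + ->]; rewrite mem_iota => /andP[_ /rhoP[]].
rewrite uniq_rootsE map_inj_in_uniq ?iota_uniq // => i j.
rewrite !mem_iota /= !add0n => it jt rij.
by have [h|h|//] := ltngtP i j; [have := rlt _ _ h jt | have := rlt _ _ h it];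
  rewrite rij ltxx.
Qed.

(** Exactly the [size rs - i.+1] factors coming from the roots above the midpoint are negative
    there. *)
Lemma midpoint_sign (F : realFieldType) (rs : seq F) (i : nat) :
  sorted <%R rs -> (i.+1 < size rs)%N ->
  0 < (-1) ^+ (size rs - i.+1) *
      (\prod_(r <- rs) ('X - r%:P)).[(rs`_i + rs`_i.+1) / 2].
Proof.
move=> srt isz; set m := (_ / 2).
have nth_lt a b : (a < b)%N -> (b < size rs)%N -> rs`_a < rs`_b.
  by move=> ab bs; rewrite (sorted_ltn_nth lt_trans) // inE ?(ltn_trans ab).
have nth_le a b : (a <= b)%N -> (b < size rs)%N -> rs`_a <= rs`_b.
  by rewrite leq_eqVlt => /orP[/eqP->//|ab] bs; rewrite ltW ?nth_lt.
have := nth_lt i i.+1 (ltnSn i) isz => mi.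
have im : rs`_i < m by rewrite /m; lra.
have mi1 : m < rs`_i.+1 by rewrite /m; lra.
rewrite horner_prod (big_nth 0) /= (big_cat_nat (n := i.+1)) //=; last exact: ltnW.
rewrite mulrCA pmulr_rgt0; last first.
  rewrite big_nat_cond prodr_gt0 // => j /andP[/andP[_ ji] _].
  rewrite hornerXsubC subr_gt0 (le_lt_trans _ im) // nth_le //.
  exact: ltn_trans isz.
rewrite -prodr_const_nat -big_split /= big_nat_cond prodr_gt0 //.
move=> j /andP[/andP[ij js] _].
by rewrite hornerXsubC mulN1r opprB subr_gt0 (lt_le_trans mi1) // nth_le.
Qed.

Lemma uniform_threshold (F : realDomainType) (P : nat -> F -> Prop) (n : nat) :
  (forall i, (i < n)%N -> exists a0, forall a, a0 <= a -> P i a) ->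
  exists a0, forall a, a0 <= a -> forall i, (i < n)%N -> P i a.
Proof.
elim: n => [|n IH] h; first by exists 0.
have [i /ltnW/h//|a1 h1] := IH; have [a2 h2] := h n (ltnSn n).
exists (Num.max a1 a2) => a; rewrite ge_max => /andP[aa1 aa2] i.
by rewrite ltnS leq_eqVlt => /orP[/eqP->|]; [exact: h2 | exact: h1].
Qed.

(** The polynomial changes sign as often as its degree along -2, the midpoints, 2 and a far point.
    The odd size of [ds] makes the value -1 at 2 fit the alternation; the root beyond 2 is [b]. *)
Lemma trace_poly_roots (F : rcfType) (ds : seq F) :
  uniq ds -> odd (size ds) -> -2 \in ds -> 2 \in ds -> 2^-1 \notin ds ->
  {in ds, forall r : F, -2 <= r <= 2} ->
  exists a0 : F, forall a, a0 <= a -> exists b, exists rs,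
    [/\ 2 < b, {in rs, forall r : F, -2 < r < 2}, size rs = (size ds).+1 &
        \prod_(r <- ds) ('X - r%:P) * ('X^2 - a%:P * (2%:P * 'X - 1)) - 1
        = ('X - b%:P) * \prod_(r <- rs) ('X - r%:P)].
Proof.
move=> uds ods dsN2 ds2 dsh dsle.
(* The coefficient of [a] is -D(x) (2x - 1), so 1/2 joins the roots of D. *)
pose rs := sort <=%R (2^-1 :: ds).
have [s sE] : {s | s = (size ds).+1} by exists (size ds).+1.
have sz_rs : size rs = s by rewrite size_sort sE.
have es : ~~ odd s by rewrite sE /= ods.
have s1 : (1 < s)%N by rewrite sE ltnS; case: (ds) ods.
have s1' : (s.-1 < s)%N by rewrite ltn_predL ltnW.
have srt : sorted <%R rs by rewrite sort_lt_sorted /= dsh.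
have mem_rs r : (r \in rs) = (r == 2^-1) || (r \in ds) by rewrite mem_sort inE.
have rs_le r : r \in rs -> -2 <= r <= 2.
  by rewrite mem_rs => /orP[/eqP->|/dsle//]; apply/andP; split; lra.
have nth_lt i j : (i < j)%N -> (j < s)%N -> rs`_i < rs`_j.
  by move=> ij js; rewrite (sorted_ltn_nth lt_trans) // inE sz_rs ?(ltn_trans ij).
have nth_le i j : (i <= j)%N -> (j < s)%N -> rs`_i <= rs`_j.
  by rewrite leq_eqVlt => /orP[/eqP->//|ij] js; rewrite ltW ?nth_lt.
have rs_lt i : (i < s)%N -> -2 <= rs`_i <= 2.
  by move=> h; rewrite rs_le // mem_nth // sz_rs.
have rs0 : rs`_0 = -2.
  have m : -2 \in rs by rewrite mem_rs dsN2 orbT.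
  apply/le_anti; have /andP[-> _] := rs_lt 0%N (ltnW s1); rewrite andbT.
  by rewrite -(nth_index 0 m) nth_le // -sz_rs index_mem.
have rss : rs`_s.-1 = 2.
  have m : 2 \in rs by rewrite mem_rs ds2 orbT.
  apply/le_anti; have /andP[_ ->] := rs_lt s.-1 s1'.
  by rewrite -{1}(nth_index 0 m) nth_le // -ltnS (ltn_predK s1) -sz_rs index_mem.
pose m i := (rs`_i + rs`_i.+1) / 2.
have m_gt i : (i.+1 < s)%N -> rs`_i < m i.
  by move=> h; have := nth_lt i i.+1 (ltnSn i) h; rewrite /m; lra.
have m_lt i : (i.+1 < s)%N -> m i < rs`_i.+1.
  by move=> h; have := nth_lt i i.+1 (ltnSn i) h; rewrite /m; lra.
pose D := \prod_(r <- ds) ('X - r%:P).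
pose R a := D * ('X^2 - a%:P * (2%:P * 'X - 1)) - 1.
have RE a x : (R a).[x] = D.[x] * (x ^+ 2 - a * (2 * x - 1)) - 1.
  by rewrite /R !hornerE.
have [a1 a1P] : exists a0, forall a, a0 <= a -> forall i, (i < s.-1)%N ->
    0 < (-1) ^+ i * (R a).[m i].
  apply: (@uniform_threshold _ (fun i a => 0 < (-1) ^+ i * (R a).[m i])).
  move=> i i_s; have := @midpoint_sign F rs i srt.
  have i_s' : (i.+1 < s)%N by rewrite -(ltn_predK s1).
  rewrite sz_rs => /(_ i_s').
  have -> : (\prod_(r <- rs) ('X - r%:P)).[(rs`_i + rs`_i.+1) / 2] =
            D.[m i] * (m i - 2^-1).
    rewrite (perm_big (2^-1 :: ds)); last by rewrite /rs perm_sort.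
    by rewrite big_cons hornerM hornerXsubC mulrC.
  have -> : (-1) ^+ (s - i.+1) = - (-1) ^+ i :> F.
    rewrite -signr_odd oddB ?(negPf es) ?(ltnW i_s') // -(signr_odd _ i) /=.
    by case: (odd i); rewrite ?opprK.
  set e : F := (-1) ^+ i; set c := - e * _ => c_gt0.
  (* [e] times the value at [m i] is affine in [a] with slope [2 * c]; beyond this bound the slope
     term dominates the constant one. *)
  exists (`|e * (D.[m i] * m i ^+ 2 - 1)| / (2 * c) + 1) => a ha.
  have {ha} : `|e * (D.[m i] * m i ^+ 2 - 1)| < 2 * c * a.
    have c2 : 0 < 2 * c by rewrite mulr_gt0.
    by rewrite [2 * c * a]mulrC -ltr_pdivrMr // (lt_le_trans _ ha) // ltrDl.
  rewrite RE ltr_norml => /andP[h _].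
  have -> : e * (D.[m i] * (m i ^+ 2 - a * (2 * m i - 1)) - 1) =
            e * (D.[m i] * m i ^+ 2 - 1) + 2 * c * a.
    by rewrite /c; field.
  lra.
exists (Num.max a1 0) => a; rewrite ge_max => /andP[aa1 a_ge0].
(* [y] interleaves -2, the midpoints of consecutive roots, 2, and a point
   where the quadratic factor is already large. *)
pose y j := if j == 0%N then -2 else if (j < s)%N then m j.-1 else
            if j == s then 2 else 2 * a + 3.
have y0 : y 0%N = -2 by [].
have ym i : (i.+1 < s)%N -> y i.+1 = m i by move=> h; rewrite /y /= h.
have ys : y s = 2 by rewrite /y gtn_eqF ?(ltnW s1) // ltnn eqxx.
have ys1 : y s.+1 = 2 * a + 3 by rewrite /y /= ltnNge leqnSn /= gtn_eqF.
have Dds r : r \in ds -> D.[r] = 0 by move=> rds; apply/rootP; rewrite root_prod_XsubC.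
(* At -2 and 2 the value is -1, which alternates with the signs at the midpoints because [s] is
   even. *)
have ysign j : (j < s.+2)%N -> 0 < (-1) ^+ j.+1 * (R a).[y j].
  case: j => [|j]; first by rewrite y0 RE Dds // => _; lra.
  rewrite !ltnS leq_eqVlt => /orP[/eqP->|].
    rewrite ys1 -signr_odd /= (negPf es) /= expr0 mul1r RE subr_gt0.
    (* At 2a + 3 the terms in a^2 of the quadratic factor cancel, leaving 7a + 9; all roots of [D]
       are at most 2, so [D] is at least 1 there. *)
    have D_ge1 : 1 <= D.[2 * a + 3].
      rewrite horner_prod big_seq; apply: (big_ind (fun x => 1 <= x)) => //.
        by move=> u v u1 v1; rewrite mulr_ege1.
      by move=> r /dsle /andP[_ r2]; rewrite hornerXsubC; lra.
    have -> : (2 * a + 3) ^+ 2 - a * (2 * (2 * a + 3) - 1) = 7 * a + 9 by ring.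
    apply: (@lt_le_trans _ _ (7 * a + 9)); first by lra.
    by rewrite ler_peMl //; lra.
  rewrite leq_eqVlt => /orP[/eqP jE|js].
    by rewrite jE ys RE Dds // -signr_odd /= (negPf es) /= expr1; lra.
  by rewrite ym // !exprS !mulN1r opprK a1P // -ltnS (ltn_predK s1).
have ylt i : (i < s.+1)%N -> y i < y i.+1.
  case: i => [|i]; first by rewrite y0 ym // -rs0 m_gt.
  rewrite ltnS leq_eqVlt => /orP[/eqP->|i_s]; first by rewrite ys ys1; lra.
  rewrite ym //; case: (ltnP i.+2 s) => h.
    by rewrite ym // (lt_trans (m_lt _ i_s)) // m_gt.
  have s_eq : s = i.+2 by apply/eqP; rewrite eqn_leq h.
  by rewrite -s_eq ys -rss s_eq m_lt.
have R_mon : R a \is monic /\ size (R a) = s.+2.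
  have sD : size D = s by rewrite sE size_prod_XsubC.
  have sQ : (size (a%:P * (2%:P * 'X - 1))%R < size ('X^2 : {poly F}))%N.
    rewrite size_polyXn ltnS mul_polyC (leq_trans (size_scale_leq _ _)) //.
    rewrite (leq_trans (size_polyD _ _)) // geq_max size_polyN size_poly1 andbT.
    by rewrite mul_polyC (leq_trans (size_scale_leq _ _)) // size_polyX.
  have DQ_mon : D * ('X^2 - a%:P * (2%:P * 'X - 1)) \is monic.
    rewrite monicMl ?monic_prod_XsubC //.
    by rewrite monicE lead_coefDl ?size_polyN // lead_coefXn.
  have sDQ : size (D * ('X^2 - a%:P * (2%:P * 'X - 1))) = s.+2.
    rewrite size_monicM ?monic_prod_XsubC // ?sD ?size_polyDl ?size_polyN //.
      by rewrite size_polyXn addn3.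
    by rewrite -size_poly_eq0 size_polyDl ?size_polyN // size_polyXn.
  by rewrite /R monicE lead_coefDl ?size_polyDl ?size_polyN ?size_poly1 ?sDQ // -monicE.
have [//||rho rhoP Rrho] := @roots_of_sign_changes F (R a) s.+1 y R_mon.1 R_mon.2.
- move=> i i_s; have := ysign i (ltnW i_s); have := ysign i.+1 i_s.
  move=> h1 h2; have := mulr_gt0 h1 h2.
  rewrite mulrACA -exprD addSn addnn exprS -mul2n mulnC exprM sqrr_sign.
  by rewrite mulr1 mulN1r oppr_gt0 mulrC.
exists (rho s), [seq rho i | i <- iota 0 s].
have y_le i : (i <= s)%N -> -2 <= y i <= 2.
  case: i => [_|i]; first by rewrite y0; apply/andP; split; lra.
  rewrite leq_eqVlt => /orP[/eqP->|i_s]; first by rewrite ys; apply/andP; split; lra.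
  rewrite ym // -{1}rs0 -rss (le_trans _ (ltW (m_gt _ i_s))) ?nth_le // 1?ltnW //.
  by rewrite (le_trans (ltW (m_lt _ i_s))) ?nth_le // -ltnS (ltn_predK s1).
split.
- by rewrite -ys; have [] := rhoP s (ltnSn s).
- move=> _ /mapP[i + ->]; rewrite mem_iota => /andP[_ i_s].
  have [h1 h2] := rhoP i (ltnW i_s : (i < s.+1)%N).
  have /andP[h3 _] := y_le i (ltnW i_s); have /andP[_ h4] := y_le i.+1 i_s.
  by rewrite (le_lt_trans h3 h1) (lt_le_trans h2 h4).
- by rewrite size_map size_iota sE.
- rewrite -/(R a) Rrho big_ord_recr /= mulrC big_map; congr (_ * _).
  by rewrite -(big_mkord xpredT (fun i => 'X - (rho i)%:P)) /index_iota subn0.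
Qed.

(** * Traces of roots of unity *)

Lemma half_notin_Aint : (2^-1 : algC) \notin Aint.
Proof.
apply/negP=> /Cint_rat_Aint; rewrite rpredV rpred_nat => /(_ isT) /intrP[z zE].
have : (2 * z)%:~R = 1%:~R :> algC by rewrite intrM -zE mulfV ?pnatr_eq0.
by move=> /intr_inj; lia.
Qed.

(** The traces are w^j + w^(-j) for 0 <= j <= k, with [w] a primitive 2k-th root of unity; each
    quadratic factor splits as (z - w^j) (z - w^(-j)). *)
Lemma cyclotomic_traces (k : nat) : (0 < k)%N -> exists ds : seq algR,
  [/\ uniq ds /\ size ds = k.+1, -2 \in ds /\ 2 \in ds, 2^-1 \notin ds,
      {in ds, forall r : algR, -2 <= r <= 2} &
      forall z : algC, \prod_(r <- ds) (z ^+ 2 - algRval r * z + 1) =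
        (z ^+ 2 - 1) * (z ^+ (2 * k) - 1)].
Proof.
move=> k_gt0; have k2_gt0 : (0 < 2 * k)%N by rewrite muln_gt0.
have [w prim_w] := C_prim_root_exists k2_gt0.
have w2k : w ^+ (2 * k) = 1 := prim_expr_order prim_w.
have w_neq0 : w != 0 by have := oner_neq0 algC; rewrite -w2k expf_eq0 k2_gt0.
have norm_w : `|w| = 1.
  apply/eqP; rewrite -(@pexpr_eq1 _ _ (2 * k)) //.
  by rewrite -normrX w2k normr1.
have wj_neq0 j : w ^+ j != 0 by rewrite expf_neq0.
have conj_w j : (w ^+ j)^* = (w ^+ j)^-1.
  by rewrite invC_norm normrX norm_w !expr1n invr1 mul1r.
(* Taken as twice a real part, the trace is an element of the real closed field [algR]. *)
pose c j : algR := in_algR (Creal_Re (w ^+ j)) *+ 2.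
have cE j : algRval (c j) = w ^+ j + (w ^+ j)^-1.
  by rewrite /c rmorphMn /= -mulr_natr ReE -conj_w mulfVK ?pnatr_eq0.
have wk : w ^+ k = -1.
  have /eqP : (w ^+ k - 1) * (w ^+ k + 1) = 0.
    by rewrite -subr_sqr expr1n -exprM mulnC w2k subrr.
  rewrite mulf_eq0 subr_eq0 -(prim_order_dvd prim_w) => /orP[/dvdn_leq|].
    by move=> /(_ k_gt0); lia.
  by rewrite addr_eq0 => /eqP.
have c_ds j : (j <= k)%N -> c j \in [seq c j | j <- iota 0 k.+1].
  by move=> jk; rewrite map_f // mem_iota ltnS.
have algRval_inj : injective algRval := val_inj.
exists [seq c j | j <- iota 0 k.+1]; split.
- split; last by rewrite size_map size_iota.
  rewrite map_inj_in_uniq ?iota_uniq // => i j.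
  rewrite !mem_iota /= !add0n !ltnS => ik jk /(congr1 algRval).
  rewrite !cE => cij.
  (* Equal traces force w^i = w^j or w^(i+j) = 1; as i, j <= k, the second case leaves only i = j =
     0 and i = j = k. *)
  have : (w ^+ i - w ^+ j) * (w ^+ (i + j) - 1) =
      w ^+ i * w ^+ j * ((w ^+ i + (w ^+ i)^-1) - (w ^+ j + (w ^+ j)^-1)).
    by rewrite exprD; field; rewrite !wj_neq0.
  rewrite cij subrr mulr0 => /eqP; rewrite mulf_eq0 !subr_eq0.
  rewrite -(prim_order_dvd prim_w) (eq_prim_root_expr prim_w).
  move=> /orP[|/dvdnP[[|[|q]]]]; [|lia|lia|nia].
  by rewrite !modn_small; [move/eqP | lia | lia].
- split.
    suff -> : -2 = c k by exact: c_ds.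
    apply: algRval_inj; rewrite cE wk invrN invr1 rmorphN; ring.
  suff -> : 2 = c 0%N by exact: c_ds.
  by apply: algRval_inj; rewrite cE expr0 invr1.
(* A trace is the sum of a root of unity and its conjugate, hence an algebraic integer, unlike
   1/2. *)
- apply/negP=> /mapP[j _ /(congr1 algRval)]; rewrite cE fmorphV rmorph_nat => h.
  have /negP := half_notin_Aint; apply; rewrite h -conj_w rpredD //.
    by rewrite rpredX // (Aint_prim_root prim_w).
  by rewrite Aint_aut rpredX // (Aint_prim_root prim_w).
- move=> _ /mapP[j _ ->]; rewrite -ler_norml.
  change (`|algRval (c j)| <= algRval 2).
  rewrite cE rmorph_nat (le_trans (ler_normD _ _)) //.
  by rewrite normfV normrX norm_w expr1n invr1.
move=> z; rewrite big_map.
(* Written as 2k - j, the exponents -j run from k to 2k. Together with 0..k they meet every residue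
   modulo 2k once, except 0 and k, met twice: hence the extra factor z^2 - 1. *)
have -> : \prod_(j <- iota 0 k.+1) (z ^+ 2 - algRval (c j) * z + 1) =
    \prod_(0 <= j < k.+1) (z - w ^+ j) * \prod_(k <= j < (2 * k).+1) (z - w ^+ j).
  rewrite [X in _ * X]big_nat_rev (_ : (2 * k).+1 = k.+1 + k)%N; last by lia.
  rewrite -{3}[k]add0n big_addn addnK -big_split /index_iota subn0.
  rewrite !big_seq; apply: eq_bigr => j; rewrite mem_iota add0n => /andP[_ jk].
  have -> : (k + (k.+1 + k) - (j + k).+1 = 2 * k - j)%N by lia.
  have -> : w ^+ (2 * k - j) = (w ^+ j)^-1.
    apply: (mulfI (wj_neq0 j)); rewrite -exprD subnKC ?w2k ?mulfV //; lia.
  by rewrite cE /=; field; exact: wj_neq0.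
have -> : z ^+ (2 * k) - 1 = \prod_(0 <= j < 2 * k) (z - w ^+ j).
  have := congr1 (fun p => p.[z]) (factor_Xn_sub_1 prim_w).
  rewrite horner_prod !hornerE => <-.
  by apply: eq_bigr => j _; rewrite hornerXsubC.
rewrite big_nat_recr //= big_nat_recr ?leq_pmull //= w2k wk.
rewrite [\prod_(0 <= j < 2 * k) _](@big_cat_nat _ _ _ k) ?leq_pmull //=.
by ring.
Qed.

(** * Integer polynomials with all roots in the closed unit disc *)

Local Notation pZtoC := (map_poly (intr : int -> algC)).
Local Notation pZtoQ := (map_poly (intr : int -> rat)).
Local Notation pQtoC := (map_poly (ratr : rat -> algC)).

Lemma Aint_root_int (P : {poly int}) (z : algC) :
  P \is monic -> root (pZtoC P) z -> z \in Aint.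
Proof.
move=> Pmon Pz; apply: root_monic_Aint Pz _ _; first by rewrite monic_map.
by apply/polyOverP=> i; rewrite coef_map /= rpred_int.
Qed.

(** Multiplying by X - z with |z| <= 1 at most doubles a bound on the coefficients. *)
Lemma coef_prod_disc (s : seq algC) (i : nat) :
  {in s, forall z : algC, `|z| <= 1} ->
  `|(\prod_(z <- s) ('X - z%:P))`_i| <= 2 ^+ size s.
Proof.
elim: s i => [|z s IH] i zs.
  by rewrite big_nil coef1; case: (i == 0%N); rewrite ?normr1 ?normr0.
have {}IH j : `|(\prod_(z <- s) ('X - z%:P))`_j| <= 2 ^+ size s.
  by apply: IH => u us; apply: zs; rewrite inE us orbT.
rewrite big_cons mulrBl coefB coefXM coefCM exprS mulr_natl mulr2n.
rewrite (le_trans (ler_normB _ _)) // lerD //.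
  by case: (i == 0%N); rewrite ?normr0 ?exprn_ge0.
by rewrite normrM (le_trans _ (IH i)) // ler_piMl // zs // mem_head.
Qed.

Lemma finite_bounded_polys (m C : nat) :
  finite_set [set p : {poly int} | (size p <= m)%N /\ forall i, `|p`_i| <= C%:Z].
Proof.
(* Coefficients are shifted by [C] into 0..2C, so that a function between finite types encodes the
   polynomial. *)
pose f (g : {ffun 'I_m -> 'I_(2 * C).+1}) : {poly int} :=
  \poly_(i < m) (if insub i is Some j then (g j : nat)%:Z - C%:Z else 0).
apply: (@sub_finite_set _ _ (f @` setT)); last first.
  exact/finite_image/finite_finset.
move=> p [sp cp]; exists [ffun i : 'I_m => inord `|p`_i + C%:Z|] => //.
apply/polyP=> i; rewrite coef_poly; case: ltnP => im; last first.
  by rewrite nth_default // (leq_trans sp).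
have := cp i; rewrite ler_norml => /andP[cl cu].
by rewrite insubT ffunE /=; move: (p`_i) cl cu => x cl cu; rewrite inordK; lia.
Qed.

(** Kronecker's argument: the degree and the location of the roots bound the coefficients, which are
    integers. *)
Lemma finite_disc_polys (m : nat) :
  finite_set [set p : {poly int} | [/\ p \is monic, (size p <= m)%N &
    forall z, root (pZtoC p) z -> `|z| <= 1]].
Proof.
apply: sub_finite_set (finite_bounded_polys m (2 ^ m)).
move=> p [pmon sp proot]; split=> // i.
have [s ps] := closed_field_poly_normal (pZtoC p).
have pCmon : pZtoC p \is monic by rewrite monic_map.
move: ps; rewrite (monicP pCmon) scale1r => ps.
have /(_ i) := @coef_prod_disc s _ _; rewrite -ps coef_map /=.
have ss : (size s <= m)%N.
  rewrite ltnW // (leq_trans _ sp) // -(size_map_inj_poly (@intr_inj algC)) //.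
  by rewrite ps size_prod_XsubC.
have h : {in s, forall z, `|z| <= 1}.
  by move=> z zs; apply: proot; rewrite ps root_prod_XsubC.
move=> /(_ h) {}h; rewrite -(ler_int algC) intr_norm (le_trans h) //.
by rewrite -natrX ler_nat leq_pexp2l.
Qed.

(** As [alpha] is an algebraic integer, its minimal polynomial has integer coefficients and divides
    [P] over the integers. Cancelling X - alpha shows that the cofactor divides [T]. *)
Lemma minCpoly_cofactor (P : {poly int}) (alpha : algC) (T : {poly algC}) :
  P \is monic -> pZtoC P = ('X - alpha%:P) * T ->
  (forall z, root T z -> `|z| <= 1) ->
  exists r : {poly int},
    [/\ r \is monic, (size r <= size P)%N, forall z, root (pZtoC r) z -> `|z| <= 1 &
        pZtoC P = minCpoly alpha * pZtoC r].
Proof.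
move=> Pmon PE Troot.
have Palpha : root (pZtoC P) alpha by rewrite PE rootM root_XsubC eqxx.
have alphaA := Aint_root_int Pmon Palpha.
have pZtoQtoC pz : pQtoC (pZtoQ pz) = pZtoC pz.
  by rewrite -map_poly_comp; apply: eq_map_poly => b; rewrite /= rmorph_int.
have [q qE] := floorpP alphaA.
have [q0 [q0E q0mon q0dvd]] := minCpolyP alpha.
have q0q : q0 = pZtoQ q.
  by apply: (map_poly_inj (ratr : {rmorphism rat -> algC})); rewrite /= pZtoQtoC -q0E.
have qmon : q \is monic.
  have := minCpoly_monic alpha; rewrite qE !monicE lead_coef_map_inj //=.
    by rewrite (eqr_int algC _ 1).
  exact: intr_inj.
have qP : q %| P by rewrite -dvdp_rat_int -q0q -q0dvd pZtoQtoC.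
have [r PEr] : exists r, P = q * r.
  by exists (P %/ q); rewrite Pdiv.Idomain.divpKC // (monicP qmon) expr1n scale1r.
have rmon : r \is monic by move: Pmon; rewrite PEr monicMl.
have PEC : pZtoC P = minCpoly alpha * pZtoC r by rewrite PEr rmorphM /= qE.
exists r; split=> //.
  rewrite PEr size_monicM ?monic_neq0 //.
  have := monic_neq0 qmon; rewrite -size_poly_gt0.
  by case: (size q) => // d _; exact: leq_addl.
move=> z rz; apply: Troot.
have /factor_theorem[u uE] := root_minCpoly alpha.
have -> : T = u * pZtoC r.
  apply: (mulfI (negbT (polyXsubC_eq0 alpha))).
  by rewrite -PE PEC uE mulrCA mulrA.
by rewrite rootM rz orbT.
Qed.

(** * The reciprocal polynomials S_a *)

(** This is S_a with t = k + 3: the first two factors are z^(k+1) D(z + 1/z), the third is z^2 times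
    the quadratic factor of R_a at z + 1/z. In this form the coefficients are visibly integers. *)
Definition salem_poly (k a : nat) : {poly int} :=
  ('X^2 - 1) * ('X^(2 * k) - 1) *
    (('X^2 + 1) ^+ 2 - a%:R * 'X * (2 * 'X^2 - 'X + 2)) - 'X^(k + 3).

Definition salem_val (k a : nat) (z : algC) : algC :=
  (z ^+ 2 - 1) * (z ^+ (2 * k) - 1) *
    ((z ^+ 2 + 1) ^+ 2 - a%:R * z * (2 * z ^+ 2 - z + 2)) - z ^+ (k + 3).

Lemma horner_salem_poly k a z : (pZtoC (salem_poly k a)).[z] = salem_val k a z.
Proof.
rewrite /salem_poly /salem_val.
rewrite !(rmorphB, rmorphD, rmorphM, rmorph1, rmorph_nat, rmorphXn) /= !map_polyX.
by rewrite !(hornerMn, hornerE) /=; ring.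
Qed.

Lemma root_salem_poly k a z : root (pZtoC (salem_poly k a)) z = (salem_val k a z == 0).
Proof. by rewrite rootE horner_salem_poly. Qed.

Lemma salem_val0 k a : (0 < k)%N -> salem_val k a 0 = 1.
Proof.
move=> k_gt0; rewrite /salem_val !expr0n addn3 muln_eq0 /= gtn_eqF //=.
by ring.
Qed.

Lemma salem_val_neq0 k a z : (0 < k)%N -> salem_val k a z = 0 -> z != 0.
Proof.
by move=> k0; apply: contra_eq_neq => ->; rewrite salem_val0 ?oner_neq0.
Qed.

(** S_a is z^(k+3) times a polynomial in z + 1/z, which is invariant under inversion of z. *)
Lemma salem_valV k a z : z != 0 ->
  salem_val k a z^-1 = salem_val k a z * z ^- (2 * (k + 3)).
Proof.
move=> z0; rewrite /salem_val mulnDr ![(2 * k)%N]mulnC !exprD !exprM !exprVn.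
have zk0 : z ^+ k != 0 by rewrite expf_neq0.
move: (z ^+ k) zk0 => u u0.
by field; rewrite z0 u0.
Qed.

Lemma Aint_salem_root k a z : (0 < k)%N -> salem_poly k a \is monic ->
  salem_val k a z = 0 -> z \in Aint /\ z^-1 \in Aint.
Proof.
move=> k_gt0 Smon za; have z0 := salem_val_neq0 k_gt0 za.
by split; apply: (Aint_root_int Smon); rewrite root_salem_poly ?salem_valV ?za ?mul0r.
Qed.

(* At a root [z], [2 z^2 - z + 2] does not vanish since [z + z^-1] is an algebraic
   integer; so [salem_val k a z] is a nonconstant affine function of [a]. *)
Lemma salem_val_inj k a b z : (0 < k)%N -> salem_poly k a \is monic ->
  salem_val k a z = 0 -> salem_val k b z = 0 -> a = b.
Proof.
move=> k_gt0 Smon za zb; have z0 := salem_val_neq0 k_gt0 za.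
have [zA zVA] := Aint_salem_root k_gt0 Smon za.
(* If this product vanished, S_a(z) = 0 would reduce to z^(k+3) = 0. *)
have E_neq0 : (z ^+ 2 - 1) * (z ^+ (2 * k) - 1) != 0.
  apply/eqP=> E0; move: za; rewrite /salem_val E0 mul0r sub0r => /eqP.
  by rewrite oppr_eq0 expf_eq0 (negPf z0) andbF.
have Q_neq0 : 2 * z ^+ 2 - z + 2 != 0.
  apply/negP=> /eqP Q0; have /negP := half_notin_Aint; apply.
  suff -> : 2^-1 = z + z^-1 by rewrite rpredD.
  apply/eqP; rewrite eq_sym -subr_eq0.
  have -> : z + z^-1 - 2^-1 = (2 * z ^+ 2 - z + 2) / (2 * z).
    by field.
  by rewrite Q0 mul0r.
have : (z ^+ 2 - 1) * (z ^+ (2 * k) - 1) * (a%:R - b%:R) * (z * (2 * z ^+ 2 - z + 2)) = 0.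
  transitivity (salem_val k b z - salem_val k a z); last by rewrite za zb subrr.
  by rewrite /salem_val; ring.
move/eqP; rewrite !mulf_eq0 -mulf_eq0 (negPf E_neq0) (negPf z0) (negPf Q_neq0) !orbF /=.
by rewrite subr_eq0 eqr_nat => /eqP.
Qed.

(** * Location of the roots of S_a *)

(** The conjugate of [z] satisfies the same real equation. Either [z] is real, which the negative
    discriminant r^2 - 4 excludes, or z and its conjugate have sum r, and then their product is
    1. *)
Lemma unit_circle_of_trace (r : algR) (z : algC) :
  -2 < r < 2 -> z ^+ 2 - algRval r * z + 1 = 0 -> `|z| = 1.
Proof.
move=> /andP[rN2 r2] zr.
have rR : (algRval r)^* = algRval r by apply/CrealP/algRvalP.
have zr' : z^* ^+ 2 - algRval r * z^* + 1 = 0.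
  have := congr1 (fun u => u^*) zr.
  by rewrite !(rmorphD, rmorphN, rmorphXn, rmorphM, rmorph1, rmorph0) /= rR.
have : (z - z^*) * (z + z^* - algRval r) = 0.
  transitivity ((z ^+ 2 - algRval r * z + 1) - (z^* ^+ 2 - algRval r * z^* + 1)).
    by ring.
  by rewrite zr zr' subrr.
move/eqP; rewrite mulf_eq0 => /orP[zR|].
  have {zR} /CrealP zR : z^* = z by apply/eqP; rewrite eq_sym -subr_eq0.
  have zE : in_algR zR ^+ 2 - r * in_algR zR + 1 = 0 by exact/val_inj.
  have : (2 * in_algR zR - r) ^+ 2 = (r - 2) * (r + 2).
    transitivity (4 * (in_algR zR ^+ 2 - r * in_algR zR + 1) + (r - 2) * (r + 2)).
      by ring.
    by rewrite zE mulr0 add0r.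
  move/eqP; rewrite gt_eqF // (lt_le_trans _ (sqr_ge0 _)) // pmulr_llt0; lra.
rewrite subr_eq0 => /eqP zz; apply/eqP; rewrite -(@pexpr_eq1 _ _ 2) // normCK.
have -> : z * z^* = algRval r * z - z ^+ 2 by rewrite -zz; ring.
by rewrite -subr_eq0 -oppr_eq0 -zr; apply/eqP; ring.
Qed.

(** Substituting z + 1/z turns each linear factor X - r of R_a into (z^2 - r z + 1) / z. Evenness of
    [k] makes the number k + 1 of traces odd. *)
Lemma salem_poly_factor k : (0 < k)%N -> ~~ odd k ->
  exists a0 : nat, forall a, (a0 <= a)%N -> exists b : algR, exists rs : seq algR,
    [/\ 2 < b, {in rs, forall r : algR, -2 < r < 2}, size rs = k.+2 &
        pZtoC (salem_poly k a) =
        \prod_(r <- b :: rs) ('X^2 - (algRval r)%:P * 'X + 1)].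
Proof.
move=> k_gt0 k_even.
have [ds [[uds sds] [dsN2 ds2] dsh dsle dsE]] := cyclotomic_traces k_gt0.
have ods : odd (size ds) by rewrite sds /= k_even.
have [c0 c0P] := trace_poly_roots uds ods dsN2 ds2 dsh dsle.
exists (Num.bound `|c0|) => a ha.
have {ha} : c0 <= a%:R.
  rewrite (le_trans (ler_norm c0)) // ltW // (lt_le_trans (archi_boundP _)) //.
  by rewrite ler_nat.
move=> /c0P[b [rs [b2 rsP srs bE]]]; exists b, rs; split=> //; first by rewrite srs sds.
have eq_horner (p q : {poly algC}) : (forall z, p.[z] = q.[z]) -> p = q.
  move=> pq; apply/eqP; rewrite -subr_eq0; apply/negPn/negP=> /closed_nonrootP[z].
  by rewrite rootE hornerD hornerN pq subrr eqxx.
have prodE (s : seq algR) (z : algC) : z != 0 ->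
    \prod_(r <- s) (z ^+ 2 - algRval r * z + 1) =
    z ^+ size s * (\prod_(r <- s) ('X - (algRval r)%:P)).[z + z^-1].
  move=> z0; elim: s => [|r s IH]; first by rewrite !big_nil hornerC mulr1.
  rewrite !big_cons IH hornerM hornerXsubC.
  have -> : z ^+ 2 - algRval r * z + 1 = z * (z + z^-1 - algRval r) by field.
  by rewrite [size _]/= exprS mulrACA.
have map_prod (s : seq algR) : map_poly algRval (\prod_(r <- s) ('X - r%:P)) =
    \prod_(r <- s) ('X - (algRval r)%:P).
  rewrite rmorph_prod /=; apply: eq_bigr => r _.
  by rewrite rmorphB /= map_polyX map_polyC.
apply: eq_horner => z; rewrite horner_salem_poly horner_prod.
under eq_bigr do rewrite !hornerE.
(* The substitution is meaningless at 0, where both sides equal 1. *)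
have [->|z0] := eqVneq z 0.
  rewrite salem_val0 // big1 // => r _; ring.
have -> : \prod_(i <- b :: rs) (z * z - algRval i * z + 1) =
   \prod_(i <- b :: rs) (z ^+ 2 - algRval i * z + 1) by [].
rewrite prodE // big_cons.
have := congr1 (fun p => (map_poly algRval p).[z + z^-1]) bE.
rewrite !(rmorphB, rmorphM, rmorphXn, rmorph1, rmorph_nat) /=.
rewrite !map_prod !map_polyC !map_polyX /=.
rewrite hornerD hornerN hornerC hornerM => bE'; rewrite -bE' [size _]/= srs sds.
rewrite /salem_val -dsE prodE // sds.
have -> : ('X * 'X - a%:R * (2 * 'X - 1)).[z + z^-1] =
    (z + z^-1) ^+ 2 - a%:R * (2 * (z + z^-1) - 1) :> algC.
  by rewrite !(hornerMn, hornerE) /=; ring.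
move: (horner _ _) => d; rewrite addn3 !exprS; move: (z ^+ k) => u.
by field.
Qed.

(** The quadratic factor of trace b > 2 has the roots alpha > 1 and 1/alpha; all the others have
    their roots on the unit circle, and there are some since [rs] has k + 2 entries. *)
Lemma salem_poly_root k : (0 < k)%N -> ~~ odd k ->
  exists a0 : nat, forall a, (a0 <= a)%N ->
    [/\ salem_poly k a \is monic, size (salem_poly k a) = (2 * (k + 3)).+1,
        (exists z, salem_val k a z = 0 /\ `|z| = 1) &
        exists alpha, exists T : {poly algC},
          [/\ 1 < alpha, pZtoC (salem_poly k a) = ('X - alpha%:P) * T &
              forall z, root T z -> `|z| <= 1]].
Proof.
move=> k_gt0 k_even; have [a0 a0P] := salem_poly_factor k_gt0 k_even.
exists a0 => a /a0P[b [rs [b2 rsP srs SE]]].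
have quad_size (r : algC) : size ('X^2 - r%:P * 'X + 1 : {poly algC}) = 3%N.
  rewrite -addrA size_polyDl size_polyXn // (leq_ltn_trans (size_polyD _ _)) //.
  rewrite gtn_max size_polyN size_poly1 andbT mul_polyC.
  by rewrite (leq_ltn_trans (size_scale_leq _ _)) // size_polyX.
have quad_mon (r : algC) : 'X^2 - r%:P * 'X + 1 \is monic.
  have := quad_size r; rewrite monicE lead_coefE => ->.
  by rewrite !coefD coefN coefCM coefXn coefX coef1 /= mulr0 oppr0 !addr0.
have quad_root (r z : algC) : root ('X^2 - r%:P * 'X + 1) z = (z ^+ 2 - r * z + 1 == 0).
  by rewrite rootE !hornerE.
have Smon : salem_poly k a \is monic.
  have : pZtoC (salem_poly k a) \is monic by rewrite SE monic_prod.
  rewrite !monicE lead_coef_map_inj //=; last exact: intr_inj.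
  by rewrite (eqr_int algC _ 1).
have Ssize : size (salem_poly k a) = (2 * (k + 3)).+1.
  rewrite -(size_map_inj_poly (@intr_inj algC)) // SE size_prod_seq; last first.
    by move=> r _; rewrite monic_neq0.
  rewrite (eq_bigr (fun=> 3%N)) => [|r _]; last exact: quad_size.
  by rewrite big_const_seq count_predT iter_addn_0 /= srs; lia.
split=> //.
  case: rs rsP srs SE => // r rs rsP _ SE.
  have [z] : exists z, root ('X^2 - (algRval r)%:P * 'X + 1) z.
    by apply/closed_rootP; rewrite quad_size.
  move=> rz; exists z; split.
    apply/eqP; rewrite -root_salem_poly SE !big_cons !rootM rz.
    by rewrite orbT.
  move: rz; rewrite quad_root => /eqP; apply: unit_circle_of_trace.
  by rewrite rsP // mem_head.
(* The quadratic takes the value 2 - b < 0 at 1 and the value 1 at b. *)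
have [||x [x1 _ xroot]] := @root_between _ ('X^2 - b%:P * 'X + 1) 1 b.
- by rewrite (lt_trans _ b2) // ltr1n.
- by rewrite !hornerE; nra.
have x0 : x != 0 by rewrite gt_eqF // (lt_trans _ x1).
pose alpha := algRval x.
have alpha1 : 1 < alpha by exact: x1.
have alpha0 : alpha != 0 by rewrite gt_eqF // (lt_trans _ alpha1).
have bE : algRval b = alpha + alpha^-1.
  have bE : b = x + x^-1.
    move: xroot; rewrite rootE !hornerE => /eqP h.
    apply: (mulIf x0); rewrite mulrDl mulVf //; apply/eqP.
    by rewrite -subr_eq0 -oppr_eq0 -h; apply/eqP; ring.
  by rewrite bE rmorphD fmorphV.
exists alpha, (('X - alpha^-1%:P) * \prod_(r <- rs) ('X^2 - (algRval r)%:P * 'X + 1)).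
split=> //.
  rewrite SE big_cons mulrA; congr (_ * _); rewrite bE polyCD.
  have : alpha%:P * alpha^-1%:P = 1 :> {poly algC} by rewrite -polyCM mulfV.
  by move=> h; ring: h.
move=> z; rewrite rootM root_XsubC => /orP[/eqP->|].
  rewrite normfV invf_le1 ?normr_gt0 // (le_trans _ (real_ler_norm _)) ?ltW //.
  by rewrite gtr0_real // (lt_trans _ alpha1).
rewrite rootE horner_prod prodf_seq_eq0 => /hasP[r rrs] /=.
rewrite -rootE quad_root => /eqP.
by move=> /(unit_circle_of_trace (rsP r rrs)) ->.
Qed.

(** * Units, and infinitely many Salem numbers of a given degree *)

Lemma alg_unit_root k a n z : (0 < k)%N -> (n %| 2 * k)%N -> salem_poly k a \is monic ->
  salem_val k a z = 0 -> alg_unit (z ^+ n - 1).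
Proof.
move=> k_gt0 /dvdnP[m kE] Smon za; have z0 := salem_val_neq0 k_gt0 za.
have [zA zVA] := Aint_salem_root k_gt0 Smon za.
(* With 2k = m n, z^(2k) - 1 is z^n - 1 times the geometric sum, so S_a(z) = 0 divided by z^(k+3)
   exhibits [v] as the inverse of z^n - 1. *)
pose v := (z ^+ 2 - 1) * (\sum_(i < m) (z ^+ n) ^+ i) *
  ((z ^+ 2 + 1) ^+ 2 - a%:R * z * (2 * z ^+ 2 - z + 2)) * z^-1 ^+ (k + 3).
have vA : v \in Aint.
  have znA i : z ^+ i \in Aint by rewrite rpredX.
  rewrite /v !(rpredM, rpredB, rpredD, rpredX, rpred_nat, rpred1) //.
  by rewrite rpred_sum // => i _; rewrite rpredX.
have uv : (z ^+ n - 1) * v = 1.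
  have zk0 : z ^+ (k + 3) != 0 by rewrite expf_neq0.
  apply: (mulIf zk0); rewrite mul1r -[RHS]add0r -za /salem_val subrK.
  rewrite kE [(m * n)%N]mulnC exprM [_ ^+ m - 1]subrX1 /v exprVn.
  move: (z ^+ (k + 3)) zk0 (z ^+ n) (\sum_(i < m) (z ^+ n) ^+ i) => w w0 y t.
  by field.
have u0 : z ^+ n - 1 != 0.
  by apply: contra_eq_neq uv => ->; rewrite mul0r eq_sym oner_neq0.
split=> //; first by rewrite rpredB ?rpredX ?rpred1.
suff -> : (z ^+ n - 1)^-1 = v by [].
by apply: (mulfI u0); rewrite mulfV ?uv.
Qed.

Lemma infinite_inj_image (T : Type) (A : set nat) (f : nat -> T) :
  {in A &, injective f} -> infinite_set A -> infinite_set (f @` A).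
Proof. by move=> finj; apply: contra_not; rewrite (eq_finite_set (inj_card_eq finj)). Qed.

Lemma infinite_Salem k n : (0 < k)%N -> ~~ odd k -> (n %| 2 * k)%N ->
  infinite_set [set alpha : algC |
    [/\ Salem alpha, algdeg alpha = (2 * (k + 3))%N & alg_unit (alpha ^+ n - 1)]].
Proof.
move=> k_gt0 k_even nk; have [a0 a0P] := salem_poly_root k_gt0 k_even.
have /choice[f fP] a : exists alpha, (a0 <= a)%N -> exists T : {poly algC},
    [/\ 1 < alpha, pZtoC (salem_poly k a) = ('X - alpha%:P) * T &
       forall z, root T z -> `|z| <= 1].
  have [/a0P[_ _ _ [alpha h]]|_] := leqP a0 a; last by exists 0.
  by exists alpha.
have fval a : (a0 <= a)%N -> salem_val k a (f a) = 0.
  move=> /fP[T [_ ST _]]; apply/eqP.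
  by rewrite -root_salem_poly ST rootM root_XsubC eqxx.
have val_inj a b z : (a0 <= a)%N -> salem_val k a z = 0 -> salem_val k b z = 0 -> a = b.
  by move=> /a0P[Smon _ _ _]; exact: salem_val_inj.
(* The parameters for which S_a is reducible. *)
pose bad := [set a | (a0 <= a)%N /\ minCpoly (f a) <> pZtoC (salem_poly k a)].
have bad_fin : finite_set bad.
  (* [g] sends a bad parameter to its cofactor. The cofactor is not constant, and any root of it is
     a root of S_a and so determines [a]: hence [g] is injective, with values in a finite set. *)
  have /choice[g gP] a : exists r : {poly int}, bad a ->
      [/\ r \is monic, (size r <= (2 * (k + 3)).+1)%N,
          forall z, root (pZtoC r) z -> `|z| <= 1, 
          exists z, root (pZtoC r) z &
          forall z, root (pZtoC r) z -> salem_val k a z = 0].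
    have [[a0a Sa]|nb] := pselect (bad a); last by exists 0.
    have [Smon Ssize _ _] := a0P a a0a.
    have [T [_ ST Tdisc]] := fP a a0a.
    have [r [rmon rsize rdisc rS]] := minCpoly_cofactor Smon ST Tdisc.
    exists r => _; split=> //; first by rewrite -Ssize.
      apply/closed_rootP; rewrite size_map_inj_poly //; last exact: intr_inj.
      apply/eqP=> /eqP/size_poly1P[c c0 rc]; apply: Sa.
      move: rmon; rewrite rS rc monicE lead_coefC => /eqP->.
      by rewrite rmorph1 mulr1.
    by move=> z rz; apply/eqP; rewrite -root_salem_poly rS rootM rz orbT.
  have g_inj : {in bad &, injective g}.
    move=> a b; rewrite !in_setE => /[dup] ba /gP[_ _ _ [z gz] /(_ z gz) za].
    move=> /gP[_ _ _ _ zb] gab.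
    by apply: (val_inj a b z) => //; [case: ba | apply: zb; rewrite -gab].
  rewrite -(eq_finite_set (inj_card_eq g_inj)).
  apply: sub_finite_set (finite_disc_polys (2 * (k + 3)).+1).
  by move=> _ [a /gP[? ? ? _ _] <-].
pose good := [set a | (a0 <= a)%N /\ minCpoly (f a) = pZtoC (salem_poly k a)].
have good_inf : infinite_set good.
  move=> good_fin; apply: infinite_nat.
  have : finite_set (`I_a0 `|` (bad `|` good)).
    by rewrite !finite_setU; split; [exact: finite_II | split].
  apply: sub_finite_set => a _ /=.
  have [a0a|] := leqP a0 a; last by left.
  by right; have [h|h] := pselect (minCpoly (f a) = pZtoC (salem_poly k a));
    [right | left].
apply: (@sub_infinite_set _ (f @` good)); last first.
  apply: infinite_inj_image good_inf => a b; rewrite !in_setE => -[a0a _] [a0b _] fab.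
  by apply: (val_inj a b (f a)) => //; [exact: fval | rewrite fab; exact: fval].
move=> _ [a [a0a fS] <-].
(* For a good parameter the conjugates of [f a] are all the roots of S_a, including the one on the
   unit circle. *)
have [Smon Ssize [z1 [z1S z1norm]] _] := a0P a a0a.
have [T [f1 ST Tdisc]] := fP a a0a.
split; last exact: alg_unit_root (fval a a0a).
  split=> //.
  - by rewrite gtr0_real // (lt_trans _ f1).
  - by apply: (Aint_root_int Smon); rewrite -fS root_minCpoly.
  - move=> z; rewrite /conjugate fS ST rootM root_XsubC => /orP[->//|Tz _].
    exact: Tdisc.
  - by exists z1; split=> //; rewrite /conjugate fS root_salem_poly z1S.
by rewrite /algdeg fS size_map_inj_poly ?Ssize //; exact: intr_inj.
Qed.

Theorem theorem2 (n : nat) (hn : (0 < n)%N) :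
  exists N : set nat,
    [/\ N `<=` [set t : nat | (0 < t)%N],
        infinite_set N &
        forall t : nat, N t ->
          infinite_set [set alpha : algC |
            [/\ Salem alpha, algdeg alpha = (2 * t)%N &
                alg_unit (alpha ^+ n - 1)]]].
Proof.
(* These are t = k + 3 for k = 2n (j + 1), which is positive, even, and such that n divides 2k. *)
exists [set (2 * n * j.+1 + 3)%N | j in setT]; split.
- by move=> _ [j _ <-] /=; rewrite addn3.
- apply: infinite_inj_image infinite_nat => i j _ _ /eqP.
  by rewrite eqn_add2r eqn_pmul2l ?muln_gt0 // eqSS => /eqP.
move=> _ [j _ <-]; apply: infinite_Salem.
- by rewrite !muln_gt0 hn.
- by rewrite -mulnA oddM.
- by apply/dvdnP; exists (2 * 2 * j.+1)%N; lia.
Qed.
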